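(* For every integer $n\ge 1$, there are exactly $\dfrac{2^n\phi(N)}{2n}$ sumset-distinct sets modulo $N=2^n+1$ of cardinality $n$, where the sets are counted as subsets of $\mathbb{Z}/N\mathbb{Z}$.
   Context: A subset of $\mathbb{Z}/N\mathbb{Z}$ is called sumset-distinct modulo $N$ if all of its subsets (including the empty set, whose sum is $0$) have pairwise distinct sums in $\mathbb{Z}/N\mathbb{Z}$. Here $\phi$ is Euler's totient function. *)

(* Defs.v *)
From mathcomp Require Import all_boot all_order all_algebra.

Set Implicit Arguments.
Unset Strict Implicit.
Unset Printing Implicit Defensive.

Import GRing.Theory.
Local Open Scope ring_scope.

(* 'Z_N is Z/NZ only for N >= 2, so this is meaningful only for such N. *)
Definition sumset_distinct (N : nat) (A : {set 'Z_N}) : bool :=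
  [forall B : {set 'Z_N}, forall C : {set 'Z_N},
    [&& B \subset A, C \subset A & B != C] ==>
      (\sum_(x in B) x != \sum_(x in C) x)].

(* Main.v *)
Require Import Defs.
From mathcomp Require Import all_boot all_order all_algebra.
From mathcomp Require Import zify ring.
Set Implicit Arguments.
Unset Strict Implicit.
Unset Printing Implicit Defensive.

Import GRing.Theory.
Local Open Scope ring_scope.

(**
Write n + 1 for the size of the sets and N = 2 ^ (n + 1) + 1.  A
sumset-distinct set A of that size has 2 ^ (n + 1) = N - 1 subset sums, so
exactly one residue m is missed.  This near-tiling of the whole group is rigid.

Fix a in A.  Sorting subsets by whether they contain a shows that the sums of
A are the disjoint union of the sums of A \ a and of their translate by a.
Hence, walking along y, y + a, y + 2a, ..., membership in the sums of A \ a
alternates as long as m is avoided.  As N is odd, a closed walk cannot alternate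
all the way round, so every walk meets m: a is invertible
([unit_of_alternating]).  The walk from m then determines the sums of A \ a:
they form the progression m + a, m + 3a, m + 5a, ... of length L = 2 ^ n and
difference 2a ([alternating_odd]).

Let b be another element of A.  The same splitting says that this progression
is the disjoint union of some T and T + b.  After rescaling, the interval
{0, ..., L - 1} is T together with T + d, where b = d * 2a or b = - d * 2a and
d <= L.  Weighting each t by 2 ^ t gives
    2 ^ L - 1 = (2 ^ d + 1) * (sum of the 2 ^ t over T),
and since 2 has order 2d modulo 2 ^ d + 1, this forces 2d to divide L = 2 ^ n
([tiling_interval], [dvdn_exp2_add1]).  Thus every element of A is
2 ^ i * a up to sign for some i <= n ([max_distinct_sub_powers]); since A cannot
contain an element together with its opposite, A contains exactly one of
2 ^ i * a and - 2 ^ i * a for each i.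

Conversely every such choice of signs gives a sumset-distinct set, by
uniqueness of binary expansions ([signed_powers_distinct]).  So each unit a
belongs to exactly 2 ^ n of the sets and each non-unit to none, and counting
pairs (a, A) with a in A gives (n + 1) * #sets = phi(N) * 2 ^ n
([card_max_distinct]).
*)

(** * Powers of two *)

(** The order of 2 modulo M = 2 ^ d + 1 is 2d.  With r the remainder of L modulo
    2d, we get 2 ^ r = 1 modulo M.  If r <= d then 2 ^ r - 1 is a multiple of M
    smaller than M, so r = 0; if r > d then 2 ^ d = -1 makes 2 ^ (r - d) + 1 a
    positive multiple of M smaller than M. *)
Lemma dvdn_exp2_add1 (d L : nat) :
  (0 < d)%N -> (2 ^ d + 1 %| 2 ^ L - 1)%N -> (2 * d %| L)%N.
Proof.
move=> d_gt0; rewrite -eqn_mod_dvd ?expn_gt0 // => /eqP L1.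
set M := (2 ^ d + 1)%N in L1.
have period : 2 ^ (2 * d) = 1 %[mod M].
  apply/eqP; rewrite eqn_mod_dvd ?expn_gt0 // mulnC expnM.
  have -> : ((2 ^ d) ^ 2 - 1 = (2 ^ d - 1) * M)%N by rewrite /M -subn_sqr exp1n.
  exact: dvdn_mull.
have r1 : 2 ^ (L %% (2 * d)) = 1 %[mod M].
  rewrite -L1 {2}(divn_eq L (2 * d)) expnD [(_ %/ _ * _)%N]mulnC expnM.
  by rewrite -[RHS]modnMml -[X in _ = X * _ %[mod _]]modnXm period modnXm exp1n
    modnMml mul1n.
rewrite /dvdn; case: (posnP (L %% (2 * d))) => [// | r_gt0].
have r_lt : (L %% (2 * d) < 2 * d)%N by rewrite ltn_mod muln_gt0.
move: (L %% (2 * d))%N r_gt0 r_lt r1 => r r_gt0 r_lt r1.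
have [r_le|d_lt] := leqP r d.
  have : (2 ^ r <= 2 ^ d)%N by rewrite leq_exp2l.
  have : (2 ^ 1 <= 2 ^ r)%N by rewrite leq_exp2l.
  by move: r1; rewrite /M expn1 => + r_ge r_le'; rewrite !modn_small; lia.
have : (M %| 2 ^ (r - d) + 1)%N.
  have -> : (2 ^ (r - d) + 1 = 2 ^ (r - d) * M - (2 ^ r - 1))%N.
    rewrite /M mulnDr muln1 -expnD subnK ?(ltnW d_lt) //.
    have : (0 < 2 ^ r)%N by rewrite expn_gt0.
    by move: (2 ^ r)%N (2 ^ (r - d))%N => u v; clear; lia.
  rewrite dvdn_sub ?dvdn_mull // -eqn_mod_dvd ?expn_gt0 //; exact/eqP.
move/dvdn_leq; rewrite addn1 /M => /(_ isT).
by rewrite addn1 ltnS leq_exp2l //; lia.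
Qed.

Lemma binary_half (n : nat) (f : 'I_n.+1 -> bool) :
  (\sum_i f i * 2 ^ i = f ord0 + 2 * \sum_i f (lift ord0 i) * 2 ^ i)%N.
Proof.
rewrite big_ord_recl /= muln1 big_distrr; congr addn.
by apply: eq_bigr => i _ /=; rewrite /bump add1n expnS mulnCA.
Qed.

Lemma binary_lt (n : nat) (f : 'I_n -> bool) :
  (\sum_i f i * 2 ^ i < 2 ^ n)%N.
Proof.
elim: n f => [|n IHn] f; first by rewrite big_ord0.
rewrite binary_half expnS; have := IHn (f \o lift ord0).
move: (\sum_i _)%N => u.
by case: (f ord0) => /=; lia.
Qed.

Lemma binary_inj (n : nat) (f g : 'I_n -> bool) :
  (\sum_i f i * 2 ^ i = \sum_i g i * 2 ^ i)%N -> f =1 g.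
Proof.
elim: n f g => [|n IHn] f g; first by move=> _ [].
rewrite !binary_half => E.
have E0 : f ord0 = g ord0 by case: (f ord0) (g ord0) E => [] []; lia.
move: E; rewrite E0 => /addnI/eqP; rewrite eqn_pmul2l // => /eqP.
move=> /(IHn (f \o lift ord0) (g \o lift ord0)) E i.
by case: (unliftP ord0 i) => [j|] ->; [apply: E | apply: E0].
Qed.

(** * Tilings of cyclic groups by translates *)

Section Cyclic.
Variable N : nat.
Hypothesis N_gt1 : (1 < N)%N.
Implicit Types (x y a m : 'Z_N) (A B : {set 'Z_N}).

Lemma ltn_Zp x : (x < N)%N.
Proof. by rewrite -[X in (_ < X)%N](Zp_cast N_gt1). Qed.

Lemma natr_Zp_small k : (k < N)%N -> (k%:R : 'Z_N) = k :> nat.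
Proof. by move=> k_lt; rewrite val_Zp_nat // modn_small. Qed.

Lemma opp_Zp_val x : (0 < x)%N -> (- x)%R = (N - x)%N :> nat.
Proof.
move=> x_gt0; have x_lt := ltn_Zp x.
have -> : - x = (N - x)%:R.
  by rewrite natrB ?(ltnW x_lt) // pchar_Zp // sub0r natr_Zp.
by rewrite natr_Zp_small // ltn_subrL x_gt0 (ltn_trans _ N_gt1).
Qed.

Lemma card_unit_Zp : #|[set a : 'Z_N | a \is a GRing.unit]| = totient N.
Proof.
rewrite -card_units_Zp ?(ltnW N_gt1) //.
rewrite -(card_imset _ (@val_inj _ _ {unit 'Z_N})).
apply: eq_card => a; rewrite inE; apply/idP/imsetP => [a_unit|[u _ ->]].
  by exists (FinRing.unit _ a_unit); rewrite ?inE.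
exact: (valP u).
Qed.

(** The weight 2 ^ y turns translation by d into multiplication by 2 ^ d, so the
    weight of the interval, 2 ^ L - 1, is 2 ^ d + 1 times that of [g].  The bound
    d <= L is what prevents the translate of an element below L from wrapping
    around N, where the weight would not be multiplicative. *)
Lemma tiling_interval (L d : nat) (g : pred 'Z_N) :
    N = (2 * L + 1)%N -> (d <= L)%N ->
    (forall y, g y -> (y < L)%N) ->
    (forall y, (y < L)%N = g y (+) g (y - d%:R)) ->
  (2 ^ d + 1 %| 2 ^ L - 1)%N.
Proof.
move=> NE d_le g_lt tile.
have geom : (\sum_(y : 'Z_N | (y < L)%N) 2 ^ y = 2 ^ L - 1)%N.
  have L_le : (L <= (Zp_trunc N).+2)%N by rewrite Zp_cast //; lia.
  rewrite -(big_ord_widen _ (fun i => 2 ^ i)%N L_le).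
  by rewrite subn1 predn_exp mul1n.
have shift : (\sum_(y : 'Z_N | g (y - d%:R)%R) 2 ^ y
    = 2 ^ d * \sum_(y | g y) 2 ^ y)%N.
  rewrite (reindex_inj (addIr (d%:R : 'Z_N))) big_distrr.
  apply: eq_big => y; rewrite addrK // => /g_lt y_lt.
  have add_nat : y + d%:R = (y + d)%:R by rewrite natrD natr_Zp.
  have sum_lt : (y + d < N)%N by clear -NE d_le y_lt; lia.
  by rewrite add_nat natr_Zp_small // expnD [LHS]mulnC.
apply/dvdnP; exists (\sum_(y | g y) 2 ^ y)%N.
rewrite -geom mulnC mulnDl mul1n -shift.
rewrite big_mkcond [X in (_ + X)%N]big_mkcond [X in (X + _)%N]big_mkcond.
rewrite -big_split /=; apply: eq_bigr => y _.
have := g_lt y; rewrite tile.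
by case: (g y); case: (g (_ - _)) => //= both; rewrite ?addn0 //;
  have := both isT.
Qed.

Lemma unit_of_alternating (f : pred 'Z_N) a m :
    odd N -> (forall y, (y != m) = f y (+) f (y - a)) ->
  a \is a GRing.unit.
Proof.
move=> N_odd alt.
(* If -1 is not a multiple of a, the walk m + 1 + k a never meets m; it closes
   up after the odd number N of steps, each of which flips f. *)
case: (boolP [exists k : 'Z_N, a * k == -1]) => [/existsP[k /eqP ak]|noinv].
  by apply/unitrPr; exists (- k); rewrite mulrN ak opprK.
have off k : m + 1 + k%:R * a != m.
  apply: contra noinv => /eqP E; apply/existsP; exists k%:R.
  by rewrite mulrC -addr_eq0 addrC -(inj_eq (addrI m)) addr0 addrA E.
have flip k : f (m + 1 + k%:R * a) = odd k (+) f (m + 1).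
  elim: k => [|k IHk]; first by rewrite mul0r addr0.
  have := alt (m + 1 + k.+1%:R * a); rewrite off -natr1 mulrDl mul1r addrA addrK.
  by rewrite IHk /=; case: (f _); case: (odd k); case: (f _).
have := flip N; rewrite pchar_Zp // mul0r addr0 N_odd /=.
by case: (f _).
Qed.

(** The walk m, m + a, m + 2a, ... starts outside [f] and, a being a unit, does
    not return to m before step N, so it alternates until then. *)
Lemma alternating_odd (f : pred 'Z_N) a m :
    a \is a GRing.unit -> (forall y, (y != m) = f y (+) f (y - a)) ->
    f m = false ->
  forall k, (k < N)%N -> f (m + k%:R * a) = odd k.
Proof.
move=> a_unit alt fm; elim=> [|k IHk] k_lt; first by rewrite mul0r addr0.
have := alt (m + k.+1%:R * a).
rewrite -{3}natr1 mulrDl mul1r addrA addrK IHk 1?ltnW //.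
have -> : m + k.+1%:R * a != m.
  rewrite -{2}[m]addr0 (inj_eq (addrI m)) -[0](mul0r a) (inj_eq (mulIr a_unit)).
  by rewrite -val_eqE /= natr_Zp_small.
by rewrite /=; case: (f _); case: (odd k).
Qed.

(** The affine coordinate y |-> c + y * b reduces the statement to the tiling of
    {0, ..., L - 1} by [g] and its translate by e / b.  Translating [g] by e
    exchanges the two tiles and changes the sign of e, which allows the shift to
    be taken at most L. *)
Lemma step_of_halved_progression (L : nat) (f g : pred 'Z_N) (c b e : 'Z_N) :
    N = (2 * L + 1)%N -> b \is a GRing.unit ->
    (forall k, (k < N)%N -> f (c + k%:R * b) = (k < L)%N) ->
    (forall y, g y -> f y) -> (forall y, f y = g y (+) g (y - e)) ->
  exists2 d : nat, (2 ^ d + 1 %| 2 ^ L - 1)%N &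
    e = d%:R * b \/ e = - (d%:R * b).
Proof.
move=> NE b_unit prog gf tile.
pose co (y : 'Z_N) := c + y * b.
have fco y : f (co y) = (y < L)%N by rewrite -prog ?ltn_Zp ?natr_Zp.
have tile' y : (y < L)%N = g (co y) (+) g (co (y - e / b)).
  by rewrite -fco tile /co mulrBl divrK ?addrA.
have [d_le|d_gt] := leqP (e / b)%R L.
  exists (e / b)%R => [|]; last by left; rewrite natr_Zp divrK.
  apply: (@tiling_interval _ _ (fun y => g (co y))) => // y.
    by move=> /gf; rewrite fco.
  by rewrite natr_Zp.
exists (- (e / b))%R => [|]; last by right; rewrite natr_Zp mulNr divrK ?opprK.
have opp_val : (- (e / b))%R = (N - (e / b)%R)%N :> nat.
  by rewrite opp_Zp_val // (leq_trans _ d_gt).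
apply: (@tiling_interval _ _ (fun y => g (co (y - e / b)))) => //.
- by rewrite opp_val; clear -NE d_gt; lia.
- move=> y gy; move: (gf (co y)) (tile' y); rewrite gy fco.
  by case: (g _) => [/(_ isT) -> | _ ->].
- by move=> y; rewrite natr_Zp opprK addrK tile' addbC.
Qed.

(** * Subset sums of sumset-distinct sets *)

Definition subset_sums A : {set 'Z_N} :=
  [set \sum_(x in B) x | B : {set 'Z_N} in powerset A].

Lemma sumset_distinctP A :
  reflect {in powerset A &, injective (fun B : {set 'Z_N} => \sum_(x in B) x)}
          (sumset_distinct A).
Proof.
apply: (iffP forallP) => [sd B C | inj B].
  rewrite !inE => BA CA E; apply/eqP; apply: contraT => BC.
  by have /forallP/(_ C) := sd B; rewrite BA CA BC E eqxx.
apply/forallP => C; apply/implyP => /and3P[BA CA]; apply: contra => /eqP E.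
by apply/eqP; apply: inj; rewrite ?inE.
Qed.

Lemma sumset_distinctS A B :
  A \subset B -> sumset_distinct B -> sumset_distinct A.
Proof.
move=> AB /sumset_distinctP inj; apply/sumset_distinctP => C D.
by rewrite !inE => CA DA; apply: inj; rewrite inE (subset_trans _ AB).
Qed.

Lemma card_subset_sums A : sumset_distinct A -> #|subset_sums A| = (2 ^ #|A|)%N.
Proof. by move/sumset_distinctP/card_in_imset; rewrite card_powerset. Qed.

Lemma subset_sumsS A B : A \subset B -> subset_sums A \subset subset_sums B.
Proof. by move=> AB; apply: imsetS; rewrite powersetS. Qed.

(** The sums split according to whether the subset contains a; distinctness of
    sums makes the two parts disjoint, hence the exclusive or. *)
Lemma subset_sumsD1 A a y : sumset_distinct A -> a \in A ->
  (y \in subset_sums A) =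
    (y \in subset_sums (A :\ a)) (+) (y - a \in subset_sums (A :\ a)).
Proof.
move=> /sumset_distinctP inj aA.
have addP B : B \subset A :\ a -> a \notin B /\ a |: B \subset A.
  rewrite subsetD1 => /andP[BA aB]; split=> //.
  by rewrite subUset sub1set aA.
have -> : (y \in subset_sums A) =
    (y \in subset_sums (A :\ a)) || (y - a \in subset_sums (A :\ a)).
  apply/imsetP/orP => [[B] | [] /imsetP[B]]; rewrite !inE.
  - move=> BA ->; case: (boolP (a \in B)) => aB; [right | left].
      rewrite (big_setD1 a) //= addrC addrK.
      by apply: imset_f; rewrite inE setSD.
    by apply: imset_f; rewrite inE subsetD1 BA.
  - by rewrite subsetD1 => /andP[BA _] ->; exists B; rewrite ?inE.
  - move=> /addP[aB aBA] E; exists (a |: B); rewrite ?inE //.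
    by rewrite big_setU1 //= -E addrC subrK.
case: imsetP => [[B] | //]; rewrite inE => BA ->.
case: imsetP => [[C] | //]; rewrite inE => CA /(canRL (subrK a)) E.
have [[aB _] [aC aCA]] := (addP _ BA, addP _ CA).
have EBC : B = a |: C.
  apply: inj; rewrite ?inE //; first by move: BA; rewrite subsetD1 => /andP[].
  by rewrite big_setU1 //= E addrC.
by move: aB; rewrite EBC setU11.
Qed.

Lemma unit_two : odd N -> (2%:R : 'Z_N) \is a GRing.unit.
Proof. by move=> N_odd; rewrite unitZpE // coprimen2. Qed.

(** Otherwise {y, - y} and the empty set have the same sum; for y = - y, which
    forces y = 0 as N is odd, use {y} instead. *)
Lemma sumset_distinct_opp A y :
  odd N -> sumset_distinct A -> y \in A -> - y \notin A.
Proof.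
move=> N_odd /sumset_distinctP inj yA; apply/negP => yA'.
have y0 : y != 0.
  apply/eqP => y0; have : [set y] = set0.
    by apply: inj; rewrite ?inE ?sub1set ?sub0set // big_set1 big_set0.
  by move/setP/(_ y); rewrite !inE eqxx.
have yy' : y != - y.
  rewrite -addr_eq0 -mulr2n -mulr_natr.
  by rewrite -[0](mul0r 2%:R) (inj_eq (mulIr (unit_two N_odd))).
have : [set y; - y] = set0.
  apply: inj; rewrite ?inE ?sub0set //; first by rewrite subUset !sub1set yA.
  by rewrite big_setU1 ?inE //= big_set1 big_set0 subrr.
by move/setP/(_ y); rewrite !inE eqxx.
Qed.

(** * Signed geometric progressions of ratio 2 *)

Definition signed_powers n (s : 'I_n -> bool) a : {set 'Z_N} :=
  [set (-1) ^+ s i * 2%:R ^+ i * a | i : 'I_n].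

(** Replacing a summand w by - w only translates all subset sums by - w, once
    membership of w is complemented.  So up to a constant the sum over X is the
    number whose binary digits are those of X flipped where s is negative. *)
Lemma sum_signed_powers n (s : 'I_n -> bool) a (X : {set 'I_n}) :
  \sum_(i in X) (-1) ^+ s i * 2%:R ^+ i * a =
   ((\sum_i ((i \in X) (+) s i) * 2 ^ i)%:R - (\sum_i s i * 2 ^ i)%:R) * a.
Proof.
rewrite !natr_sum -sumrB mulr_suml big_mkcond; apply: eq_bigr => i _.
rewrite !natrM !natrX.
by case: (i \in X); case: (s i) => /=; ring.
Qed.

Lemma sum_signed_powers_inj n (s : 'I_n -> bool) a :
  (2 ^ n < N)%N -> a \is a GRing.unit ->
  injective (fun X : {set 'I_n} => \sum_(i in X) (-1) ^+ s i * 2%:R ^+ i * a).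
Proof.
move=> nN a_unit X Y /=; rewrite !sum_signed_powers => /(mulIr a_unit)/addIr.
have small (f : 'I_n -> bool) : (\sum_i f i * 2 ^ i < N)%N.
  exact: ltn_trans (binary_lt f) nN.
move/(congr1 val); rewrite /= !natr_Zp_small // => /binary_inj E.
by apply/setP => i; have /addIb := E i.
Qed.

Lemma signed_powers_inj n (s : 'I_n -> bool) a :
  (2 ^ n < N)%N -> a \is a GRing.unit ->
  injective (fun i : 'I_n => (-1) ^+ s i * 2%:R ^+ i * a).
Proof.
move=> nN a_unit i j /= E; apply: set1_inj.
by apply: (sum_signed_powers_inj (s := s) nN a_unit); rewrite /= !big_set1.
Qed.

Lemma card_signed_powers n (s : 'I_n -> bool) a :
  (2 ^ n < N)%N -> a \is a GRing.unit -> #|signed_powers s a| = n.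
Proof.
by move=> nN a_unit; rewrite card_imset ?card_ord //; apply: signed_powers_inj.
Qed.

Lemma signed_powers_distinct n (s : 'I_n -> bool) a :
  (2 ^ n < N)%N -> a \is a GRing.unit -> sumset_distinct (signed_powers s a).
Proof.
move=> nN a_unit; apply/sumset_distinctP.
have v_inj := signed_powers_inj (s := s) nN a_unit.
set v := fun i : 'I_n => _ in v_inj.
have preimK (B : {set 'Z_N}) : B \subset signed_powers s a -> v @: (v @^-1: B) = B.
  move=> BA; apply/setP => x; apply/imsetP/idP => [[i] | xB].
    by rewrite inE => vB ->.
  have /imsetP[i _ xE] := subsetP BA x xB.
  by exists i; rewrite // inE /v -xE.
move=> B C; rewrite !inE => /preimK <- /preimK <-.
rewrite !big_imset /=; [| by move=> ? ? _ _; apply: v_inj..].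
by move/(sum_signed_powers_inj nN a_unit) ->.
Qed.
End Cyclic.

(** * Classification modulo a power of two plus one *)

Section PowerOfTwoPlusOne.
Variable n : nat.
Let N := (2 ^ n.+1 + 1)%N.

Let N_gt1 : (1 < N)%N.
Proof. by rewrite /N addn1 ltnS expn_gt0. Qed.

Let N_odd : odd N.
Proof. by rewrite /N oddD oddX. Qed.

Let pow_lt : (2 ^ n.+1 < N)%N.
Proof. by rewrite /N addn1. Qed.

Implicit Types (a : 'Z_N) (A : {set 'Z_N}).

(** This size is the largest possible: n + 2 elements have more subsets than
    there are residues modulo N. *)
Definition max_distinct A : bool := (#|A| == n.+1) && sumset_distinct A.

Lemma max_distinct_missing A :
  max_distinct A -> exists m, forall y, (y \in subset_sums A) = (y != m).
Proof.
move=> /andP[/eqP cA sdA].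
have /cards1P[m mE] : #|~: subset_sums A| == 1%N.
  by rewrite cardsCs setCK card_subset_sums // cA card_ord Zp_cast // /N addKn.
by exists m => y; rewrite -in_set1 -mE in_setC negbK.
Qed.

Lemma max_distinct_alternating A a : max_distinct A -> a \in A -> exists m,
  (forall y, (y != m) =
    (y \in subset_sums (A :\ a)) (+) (y - a \in subset_sums (A :\ a))) /\
  (m \in subset_sums (A :\ a)) = false.
Proof.
move=> gA aA; have [m mE] := max_distinct_missing gA; exists m; split=> [y|].
  by rewrite -mE (subset_sumsD1 y (proj2 (andP gA)) aA).
apply/negP => /(subsetP (subset_sumsS (subD1set A a))).
by rewrite mE eqxx.
Qed.

Lemma max_distinct_unit A a : max_distinct A -> a \in A -> a \is a GRing.unit.
Proof.
move=> gA /(max_distinct_alternating gA)[m [alt _]].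
exact: unit_of_alternating alt.
Qed.

(** The sums of A \ a form a progression of difference 2a and length 2 ^ n that
    splits into two translates by b; hence b is, up to sign, d * 2a with 2d a
    divisor of 2 ^ n. *)
Lemma max_distinct_sub_powers A a b : max_distinct A -> a \in A -> b \in A ->
  exists (s : bool) (i : 'I_n.+1), b = (-1) ^+ s * 2%:R ^+ i * a.
Proof.
move=> gA aA bA; have a_unit := max_distinct_unit gA aA.
have [<-|ab] := eqVneq a b; first by exists false, ord0; rewrite !mul1r.
have [m [alt fm]] := max_distinct_alternating gA aA.
have odds := alternating_odd N_gt1 a_unit alt fm.
have sdA := proj2 (andP gA).
have NE : N = (2 * 2 ^ n + 1)%N by rewrite /N expnS.
have prog k : (k < N)%N ->
    (m + a + k%:R * (2%:R * a) \in subset_sums (A :\ a)) = (k < 2 ^ n)%N.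
  have -> : m + a + k%:R * (2%:R * a) = m + (2 * k + 1)%:R * a.
    by rewrite natrD natrM; ring.
  have [k_lt _|k_ge k_lt] := ltnP k (2 ^ n).
    rewrite odds; first by rewrite addn1 /= mul2n odd_double.
    by rewrite NE ltn_add2r ltn_pmul2l.
  (* Beyond the first 2 ^ n terms the index wraps around N and becomes even. *)
  have -> : (2 * k + 1 = 2 * (k - 2 ^ n) + N)%N.
    by rewrite NE mulnBr addnA subnK // leq_mul2l.
  rewrite natrD pchar_Zp // addr0 odds; first by rewrite mul2n odd_double.
  by move: k_lt; rewrite NE; clear; lia.
have b_in : b \in A :\ a by rewrite !inE eq_sym ab.
have [|||d Md bE] := step_of_halved_progression N_gt1 NE _ prog
  (g := mem (subset_sums (A :\ a :\ b))) (e := b).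
- by rewrite unitrMl // unit_two.
- exact/subsetP/subset_sumsS/subD1set.
- by move=> y; apply: subset_sumsD1 b_in; apply: sumset_distinctS sdA;
  apply: subD1set.
have d_gt0 : (0 < d)%N.
  (* For d = 0 the divisor 2 ^ d + 1 = 2 would divide an odd number. *)
  case: d Md {bE} => //.
  by rewrite dvdn2 oddB ?expn_gt0 // oddX expn_eq0.
have : (2 * d %| 2 ^ n)%N by apply: dvdn_exp2_add1.
case/(dvdn_pfactor _ _ (isT : prime 2)) => i i_le dE.
have bE' : d%:R * (2%:R * a) = 2%:R ^+ i * a.
  by rewrite mulrA -natrM mulnC dE natrX.
have i_lt : (i < n.+1)%N by [].
by case: bE => ->; [exists false | exists true]; exists (Ordinal i_lt);
  rewrite /= ?expr0 ?expr1 bE' ?mulN1r ?mulNr ?mul1r.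
Qed.

(** The sign of the exponent 0 is fixed to +, so that [signed_powers] with these
    signs contains a itself and the remaining signs are unconstrained. *)
Definition free_signs (e : {ffun 'I_n -> bool}) (i : 'I_n.+1) : bool :=
  oapp e false (unlift ord0 i).

(** A set A on the left-hand side contains no two opposite elements, so reading
    off the signs from A puts each of its elements in the corresponding
    [signed_powers], and equality follows by comparing sizes. *)
Lemma max_distinct_containing_unit a : a \is a GRing.unit ->
  [set A | max_distinct A & a \in A] =
  [set signed_powers (free_signs e) a | e : {ffun 'I_n -> bool}].
Proof.
move=> a_unit; apply/setP => A; apply/idP/imsetP.
  rewrite inE => /andP[gA aA].
  pose e := [ffun i : 'I_n => - (2%:R ^+ i.+1 * a) \in A].
  have [/eqP cA sdA] := andP gA.
  have eE (i : 'I_n.+1) : free_signs e i = (- (2%:R ^+ i * a) \in A).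
    rewrite /free_signs; case: unliftP => [j|] -> /=; first by rewrite ffunE.
    by apply/esym/negbTE; rewrite mul1r sumset_distinct_opp.
  exists e => //; apply/eqP.
  rewrite eqEcard cA card_signed_powers // leqnn andbT.
  apply/subsetP => b bA; have [s [i bE]] := max_distinct_sub_powers gA aA bA.
  apply/imsetP; exists i => //; rewrite eE bE; congr (_ ^+ nat_of_bool _ * _ * _).
  case: s bE => bE; first by rewrite -mulN1r mulrA -bE bA.
  apply/esym/negbTE; rewrite (_ : _ * a = b); first exact: sumset_distinct_opp.
  by rewrite bE mul1r.
case=> e _ ->; rewrite inE /max_distinct card_signed_powers // eqxx.
rewrite signed_powers_distinct //.
apply/imsetP; exists ord0 => //.
by rewrite /free_signs unlift_none !mul1r.
Qed.

(** If two sign choices differing at an exponent gave the same set, that set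
    would contain an element and its opposite. *)
Lemma signed_powers_free_inj a : a \is a GRing.unit ->
  injective (fun e => signed_powers (free_signs e) a).
Proof.
move=> a_unit e e' /= E; apply/ffunP => j.
have sd := signed_powers_distinct N_gt1 (free_signs e) pow_lt a_unit.
apply/eqP; apply: contraT => ne.
have fr (h : {ffun 'I_n -> bool}) : free_signs h (lift ord0 j) = h j.
  by rewrite /free_signs liftK.
have mem (h : {ffun 'I_n -> bool}) : (-1) ^+ h j * 2%:R ^+ (lift ord0 j) * a \in
    signed_powers (free_signs h) a.
  by rewrite -fr; apply: imset_f.
have := sumset_distinct_opp N_gt1 N_odd sd (mem e); rewrite E.
have -> : - ((-1) ^+ e j * 2%:R ^+ lift ord0 j * a) =
          (-1) ^+ e' j * 2%:R ^+ lift ord0 j * a.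
  by case: (e j) (e' j) ne => [] [] //= _; ring.
by rewrite mem.
Qed.

(** Both sides count the pairs (a, A) with a in A. *)
Lemma card_max_distinct :
  (n.+1 * #|[set A | max_distinct A]| = totient N * 2 ^ n)%N.
Proof.
transitivity (\sum_(A | max_distinct A) \sum_(a in A) 1)%N.
  rewrite -sum1dep_card big_distrr; apply: eq_bigr => A /andP[/eqP cA _].
  by rewrite /= sum1_card cA muln1.
rewrite (exchange_big_dep predT) //=.
rewrite (bigID (mem [set a : 'Z_N | a \is a GRing.unit])) /=.
rewrite [X in (_ + X)%N]big1 ?addn0 => [|a]; last first.
  rewrite inE => a_nunit; apply: big_pred0 => A; apply/negP => /andP[gA aA].
  by move: a_nunit; rewrite (max_distinct_unit gA aA).
rewrite -card_unit_Zp // -sum_nat_const; apply: eq_bigr => a; rewrite inE => a_unit.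
rewrite sum1dep_card max_distinct_containing_unit //.
rewrite card_imset ?card_ffun ?card_bool ?card_ord //.
exact: signed_powers_free_inj.
Qed.
End PowerOfTwoPlusOne.

Theorem corollary1p6 (n : nat) (hn : (1 <= n)%N) :
  let N := (2 ^ n + 1)%N in
  (#|[set A : {set 'Z_N} | (#|A| == n) && sumset_distinct A]|%:R : rat) =
    (2 ^+ n * (totient N)%:R) / (2 * n%:R).
Proof.
case: n hn => // n _ N; have := congr1 (fun k => k%:R : rat) (card_max_distinct n).
rewrite !natrM natrX => E.
have n_neq0 : (n.+1%:R : rat) != 0 by rewrite Num.Theory.pnatr_eq0.
apply: (canRL (mulfK _)); first by rewrite mulf_neq0.
by rewrite mulrCA [_ * n.+1%:R]mulrC E exprS -!mulrA [_ ^+ n * _]mulrC.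
Qed.
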